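(* Let $a,b,c$ be distinct. The spherical tiling by $12$ edge congruent pentagons with edge lengths $a,a,b,b,c$ is, up to symmetries, given by the following assignment of lengths to the edges of the dodecahedral pattern: length $a$: $E_{1,3},E_{1,4},E_{3,4},\;E_{2,7},E_{2,11},E_{7,11},\;E_{5,6},E_{5,10},E_{6,10},\;E_{8,9},E_{8,12},E_{9,12}$; length $b$: $E_{1,2},E_{1,6},E_{2,6},\;E_{3,7},E_{3,8},E_{7,8},\;E_{4,5},E_{4,9},E_{5,9},\;E_{10,11},E_{10,12},E_{11,12}$; length $c$: $E_{1,5},E_{2,3},E_{4,8},E_{6,11},E_{7,12},E_{9,10}$.
   Context: A spherical tiling by $12$ pentagons (graph embedded in $S^2$ with all vertices of degree $\ge 3$, every tile a five-edged region enclosed by a simple closed curve; edges may be any nice curves) is combinatorially the dodecahedral pattern: tiles $P_1,\dots,P_{12}$, where $P_i$ with list $(n_1,\dots,n_5)$ has edges in cyclic order $E_{i,n_1},\dots,E_{i,n_5}$, $E_{i,j}=E_{j,i}$ being the common edge of $P_i$ and $P_j$, and (with $n_6=n_1$) $E_{i,n_k},E_{i,n_{k+1}}$ meet at the vertex $V_{i,n_k,n_{k+1}}$ of degree $3$ shared by $P_i,P_{n_k},P_{n_{k+1}}$: $P_1:(2,3,4,5,6)$; $P_2:(1,6,11,7,3)$; $P_3:(1,2,7,8,4)$; $P_4:(1,3,8,9,5)$; $P_5:(1,4,9,10,6)$; $P_6:(1,5,10,11,2)$; $P_7:(12,8,3,2,11)$; $P_8:(12,9,4,3,7)$; $P_9:(12,10,5,4,8)$;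 $P_{10}:(12,11,6,5,9)$; $P_{11}:(12,7,2,6,10)$; $P_{12}:(7,11,10,9,8)$. An edge congruent tiling is considered as an assignment of lengths to the $30$ edges such that all tiles are edge congruent, i.e. for any two tiles there is an adjacency-preserving correspondence of their edges that preserves lengths. No geometric realization by great arcs is required. ''Up to symmetries'' means up to symmetries of the dodecahedral pattern (including reflections) and of the letters $a,b$. *)

(* Defs.v *)
From HB Require Import structures.
From mathcomp Require Import all_boot all_order all_algebra.
From mathcomp Require Import reals interval_inference.
Set Implicit Arguments.
Unset Strict Implicit.
Unset Printing Implicit Defensive.

Inductive tile : Set :=
  | P1 | P2 | P3 | P4 | P5 | P6 | P7 | P8 | P9 | P10 | P11 | P12.

Definition tile_eqb (s t : tile) : bool :=
  match s, t with
  | P1, P1 | P2, P2 | P3, P3 | P4, P4 | P5, P5 | P6, P6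
  | P7, P7 | P8, P8 | P9, P9 | P10, P10 | P11, P11 | P12, P12 => true
  | _, _ => false
  end.

Lemma tile_eqP : Equality.axiom tile_eqb.
Proof. by case; case; constructor. Qed.

HB.instance Definition _ := hasDecEq.Build tile tile_eqP.

(* The tiles across the five edges of a tile, in the cyclic order of these
   edges around the tile. *)
Definition nbr (i : tile) : seq tile :=
  match i with
  | P1 => [:: P2; P3; P4; P5; P6]
  | P2 => [:: P1; P6; P11; P7; P3]
  | P3 => [:: P1; P2; P7; P8; P4]
  | P4 => [:: P1; P3; P8; P9; P5]
  | P5 => [:: P1; P4; P9; P10; P6]
  | P6 => [:: P1; P5; P10; P11; P2]
  | P7 => [:: P12; P8; P3; P2; P11]
  | P8 => [:: P12; P9; P4; P3; P7]
  | P9 => [:: P12; P10; P5; P4; P8]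
  | P10 => [:: P12; P11; P6; P5; P9]
  | P11 => [:: P12; P7; P2; P6; P10]
  | P12 => [:: P7; P11; P10; P9; P8]
  end.

(* The tiles i and j have a common edge E_{i,j}. *)
Definition adj (i j : tile) : bool := j \in nbr i.

(* E_{i,j} and E_{i,k} are edges of the tile i that meet at a vertex V_{i,j,k};
   [next] is the cyclic successor in the list. *)
Definition vertex (i j k : tile) : bool :=
  [&& adj i j, adj i k & (next (nbr i) j == k) || (next (nbr i) k == j)].

(* A length assignment is a function l of two tiles, l i j being the length of
   E_{i,j}; only its values at adjacent tiles are meaningful. *)
Definition length_assignment (L : Type) (l : tile -> tile -> L) : Prop :=
  forall i j, adj i j -> l i j = l j i.

(* Some correspondence E_{i,j} |-> E_{i',f j} from the edges of the tile i to
   those of the tile i' preserves adjacency and lengths. *)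
Definition edge_congruent (L : Type) (l : tile -> tile -> L) (i i' : tile) :
    Prop :=
  exists f : tile -> tile,
    [/\ perm_eq (map f (nbr i)) (nbr i'),
        forall j k, adj i j -> adj i k -> vertex i' (f j) (f k) = vertex i j k
      & forall j, adj i j -> l i' (f j) = l i j].

Definition edge_congruent_tiling (L : Type) (l : tile -> tile -> L) : Prop :=
  forall i i', edge_congruent l i i'.

(* Equality of multisets: the order of the lengths around a tile is not
   prescribed. *)
Definition tiles_have_lengths (L : eqType) (l : tile -> tile -> L)
    (s : seq L) : Prop :=
  forall i, perm_eq [seq l i j | j <- nbr i] s.

(* Reflections are included. *)
Definition pattern_symmetry (g : tile -> tile) : Prop :=
  [/\ bijective g,
      forall i j, adj (g i) (g j) = adj i j
    & forall i j k, vertex (g i) (g j) (g k) = vertex i j k].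

Definition a_edges : seq (tile * tile) :=
  [:: (P1, P3); (P1, P4); (P3, P4); (P2, P7); (P2, P11); (P7, P11);
      (P5, P6); (P5, P10); (P6, P10); (P8, P9); (P8, P12); (P9, P12)].

Definition b_edges : seq (tile * tile) :=
  [:: (P1, P2); (P1, P6); (P2, P6); (P3, P7); (P3, P8); (P7, P8);
      (P4, P5); (P4, P9); (P5, P9); (P10, P11); (P10, P12); (P11, P12)].

Definition c_edges : seq (tile * tile) :=
  [:: (P1, P5); (P2, P3); (P4, P8); (P6, P11); (P7, P12); (P9, P10)].

Definition standard_assignment (L : Type) (a b c : L) (l : tile -> tile -> L) :
    Prop :=
  [/\ forall e, e \in a_edges -> l e.1 e.2 = a,
      forall e, e \in b_edges -> l e.1 e.2 = b
    & forall e, e \in c_edges -> l e.1 e.2 = c].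

(* Main.v *)
Require Import Defs.
From mathcomp Require Import all_boot all_order all_algebra.
From mathcomp Require Import reals interval_inference.
Set Implicit Arguments.
Unset Strict Implicit.
Unset Printing Implicit Defensive.
Local Open Scope ring_scope.

(** In a tile with lengths a, a, b, b, c, whether the two a-edges meet and
    whether the two b-edges meet are invariant under edge congruence, so all
    tiles share these two bits.  For each of their four values, the tilings are
    found by filling in the tiles one by one, in all ways compatible with the
    tiles already filled in.  Only the value in which both pairs meet survives,
    with one tiling for each of the ten arrangements of lengths around P1; these
    ten are permuted transitively by the 5-fold rotation about P1 and the
    exchange of a and b. *)

(** * Tiles, words of lengths and symmetries of the pattern *)

(** Listed backwards because [fillings] treats the tail of a list first: the search starts at [P1],
    and every later tile touches one already filled. *)
Definition tiles : seq tile :=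
  [:: P12; P11; P10; P9; P8; P7; P6; P5; P4; P3; P2; P1].

Lemma mem_tiles i : i \in tiles. Proof. by case: i. Qed.

Lemma all_tilesP (p : pred tile) : all p tiles -> forall i, p i.
Proof. by move/allP=> h i; apply/h/mem_tiles. Qed.

Lemma adj_sym i j : adj i j = adj j i.
Proof. by move: i j => [] []. Qed.

Lemma nbr_uniq i : uniq (nbr i). Proof. by case: i. Qed.

Lemma eq_edge_congruent (L : Type) (l l' : tile -> tile -> L) i i' :
  (forall i j, adj i j -> l i j = l' i j) ->
  edge_congruent l i i' -> edge_congruent l' i i'.
Proof.
move=> ll' [f [fp fv fl]]; exists f; split=> // j ij.
rewrite -!ll' ?fl //.
by rewrite /adj -(perm_mem fp) map_f.
Qed.

Lemma edge_congruent_map (L M : Type) (h : L -> M) (l : tile -> tile -> L) i i' :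
  edge_congruent l i i' -> edge_congruent (fun i j => h (l i j)) i i'.
Proof. by move=> [f [fp fv fl]]; exists f; split=> // j ij; rewrite fl. Qed.

Definition word (L : Type) (l : tile -> tile -> L) (i : tile) : seq L :=
  [seq l i j | j <- nbr i].

Lemma eq_word (L : Type) (l l' : tile -> tile -> L) i :
  (forall i j, adj i j -> l i j = l' i j) -> word l i = word l' i.
Proof. by move=> ll'; apply/eq_in_map => j; apply: ll'. Qed.

Lemma word_map (L M : Type) (h : L -> M) (l : tile -> tile -> L) i :
  word (fun i j => h (l i j)) i = [seq h x | x <- word l i].
Proof. by rewrite /word -map_comp. Qed.

Lemma nth_word (L : Type) (x : L) (l : tile -> tile -> L) i j :
  adj i j -> nth x (word l i) (index j (nbr i)) = l i j.
Proof. by move=> ij; rewrite (nth_map i) ?index_mem // nth_index. Qed.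

Lemma pattern_symmetry_comp g h :
  pattern_symmetry g -> pattern_symmetry h -> pattern_symmetry (g \o h).
Proof.
move=> [gb ga gv] [hb ha hv]; split=> [|i j|i j k] /=; first exact: bij_comp.
  by rewrite ga.
by rewrite gv.
Qed.

Lemma pattern_symmetry_iter g n :
  pattern_symmetry g -> pattern_symmetry (iter n g).
Proof.
move=> gs; elim: n => [|n ih]; first by split=> //; exists id.
exact: (pattern_symmetry_comp gs ih).
Qed.

Lemma perm_nbr_symmetry g i :
  pattern_symmetry g -> perm_eq (map g (nbr i)) (nbr (g i)).
Proof.
move=> [[h hg gh] ga _]; apply: uniq_perm; rewrite ?nbr_uniq //.
  by rewrite map_inj_uniq ?nbr_uniq //; apply: can_inj hg.
move=> j; rewrite -[j]gh mem_map; last exact: can_inj hg.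
by rewrite -!/(adj _ _) ga.
Qed.

(** Conjugating a correspondence by [g] gives one between the image tiles. *)
Lemma edge_congruent_symmetry (L : Type) (l : tile -> tile -> L) g i i' :
  pattern_symmetry g -> edge_congruent (fun i j => l (g i) (g j)) i i' ->
  edge_congruent l (g i) (g i').
Proof.
move=> gs [f [fp fv fl]]; case: (gs) => [[h hg gh] ga gv].
have adjh k j : adj (g k) j -> adj k (h j) by rewrite -{1}[j]gh ga.
exists (g \o f \o h); split=> [|j k /adjh ij /adjh ik|j /adjh ij] /=.
- apply: perm_trans (perm_nbr_symmetry i' gs).
  apply: perm_trans (perm_map g fp).
  have -> : map g (map f (nbr i)) = map (g \o f \o h) (map g (nbr i)).
    by rewrite -!map_comp; apply: eq_map => j /=; rewrite hg.
  by rewrite perm_map // perm_sym perm_nbr_symmetry.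
- by rewrite gv fv // -gv !gh.
- by rewrite fl // gh.
Qed.

(** * The standard assignment is an edge congruent tiling *)

(** The edge lists contain each edge in one orientation only, so both orientations are looked up. *)
Definition pattern (L : Type) (a b c : L) (i j : tile) : L :=
  if ((i, j) \in a_edges) || ((j, i) \in a_edges) then a
  else if ((i, j) \in b_edges) || ((j, i) \in b_edges) then b else c.

Lemma pattern_map (L M : Type) (h : L -> M) a b c i j :
  h (pattern a b c i j) = pattern (h a) (h b) (h c) i j.
Proof. by rewrite /pattern; case: ifP => // _; case: ifP. Qed.

Lemma standard_assignmentP (L : Type) (a b c : L) l :
  length_assignment l ->
  standard_assignment a b c l <->
  (forall i j, adj i j -> l i j = pattern a b c i j).
Proof.
move=> hl; split=> [[la lb lc] i j ij|lp].
  rewrite /pattern; case: ifP => [/orP[/la//|/la/= <-]|na]; first exact: hl.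
  case: ifP => [/orP[/lb//|/lb/= <-]|nb]; first exact: hl.
  have /orP[/lc//|/lc/= <-] : ((i, j) \in c_edges) || ((j, i) \in c_edges).
    by move: i j ij na nb => [] [].
  exact: hl.
(* Each edge list is checked by computation on the labels 0, 1, 2, which [nth] then turns into
   lengths. *)
have edges s (x : L) k : nth x [:: a; b; c] k = x ->
    all (fun e => adj e.1 e.2 && (pattern 0 1 2 e.1 e.2 == k)%N) s ->
    forall e, e \in s -> l e.1 e.2 = x.
  move=> kx /allP h e /h /andP[/lp -> /eqP ek].
  by rewrite -[RHS]kx -ek (pattern_map (nth x [:: a; b; c])).
split; [exact: (edges _ _ 0%N) | exact: (edges _ _ 1%N) | exact: (edges _ _ 2%N)].
Qed.

(* The neighbours of i in the cyclic order, in the direction and with the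
   starting point for which the lengths read c, a, a, b, b in the pattern. *)
Definition aligned_nbr (i : tile) : seq tile :=
  let s := rot (index 2%N (word (pattern 0 1 2)%N i)) (nbr i) in
  if pattern 0 1 2 i (nth i s 1) == 0%N then s else rotr 1 (rev s).

Definition align (i i' j : tile) : tile :=
  nth j (aligned_nbr i') (index j (aligned_nbr i)).

Lemma pattern_edge_congruent (L : Type) (a b c : L) :
  edge_congruent_tiling (pattern a b c).
Proof.
(* With labels for lengths the claim is decidable by computation; the default value of [nth c
   [:: a; b]] sends the label 2 to [c]. *)
suff h i i' : edge_congruent (pattern 0 1 2)%N i i'.
  move=> i i'; have := edge_congruent_map (nth c [:: a; b]) (h i i').
  by apply: eq_edge_congruent => j k _; rewrite (pattern_map (nth c [:: a; b])).
have : all (fun i => all (fun i' =>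
    [&& perm_eq (map (align i i') (nbr i)) (nbr i'),
        all (fun j => all (fun k =>
          vertex i' (align i i' j) (align i i' k) == vertex i j k)
          (nbr i)) (nbr i)
      & all (fun j => pattern 0 1 2 i' (align i i' j) == pattern 0 1 2 i j)%N
          (nbr i)]) tiles) tiles by vm_compute.
move=> /all_tilesP/(_ i)/all_tilesP/(_ i')/and3P[fp /allP fv /allP fl].
exists (align i i'); split=> // [j k ij ik|j ij]; last exact/eqP/fl.
by have /allP/(_ k ik)/eqP := fv j ij.
Qed.

Lemma pattern_lengths (L : eqType) (a b c : L) :
  tiles_have_lengths (pattern a b c) [:: a; a; b; b; c].
Proof.
move=> i; have /(perm_map (nth c [:: a; b])) :
    perm_eq (word (pattern 0 1 2)%N i) [:: 0; 0; 1; 1; 2]%N by case: i.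
rewrite -(word_map (nth c [:: a; b])) (eq_word (l' := pattern a b c)) // => j k _.
by rewrite (pattern_map (nth c [:: a; b])).
Qed.

(** Both properties hold for [pattern], and [g] carries them to [l] because every tile is some
    [g (h i)]. *)
Lemma standard_assignment_tiling (L : eqType) (a b c : L) l g :
  length_assignment l -> pattern_symmetry g ->
  standard_assignment a b c (fun i j => l (g i) (g j)) ->
  edge_congruent_tiling l /\ tiles_have_lengths l [:: a; a; b; b; c].
Proof.
move=> hl gs; case: (gs) => [[h hg gh] ga _].
rewrite standard_assignmentP => [lp|i j ij]; last by rewrite hl ?ga.
split=> [i i'|i].
  rewrite -[i]gh -[i']gh; apply: edge_congruent_symmetry => //.
  have := pattern_edge_congruent a b c (h i) (h i').
  by apply: eq_edge_congruent => j k /lp.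
rewrite -[i]gh.
rewrite (perm_trans _ (pattern_lengths a b c (h i))) //.
rewrite -!/(word _ _) -(eq_word _ lp) perm_sym /word.
have /(perm_map (l (g (h i)))) := perm_nbr_symmetry (h i) gs.
by rewrite -map_comp.
Qed.

(** * Meeting of edges of equal length, an invariant of edge congruence *)

Definition cyclic_double (L : eqType) (x : L) (w : seq L) : bool :=
  (x, x) \in zip w (rot 1 w).

Lemma cyclic_double_word (L : eqType) (x : L) l i :
  cyclic_double x (word l i) =
  has (fun j => (l i j == x) && (l i (next (nbr i) j) == x)) (nbr i).
Proof.
by case: i; rewrite /cyclic_double /= !inE !xpair_eqE !orbF !(eq_sym x).
Qed.

Lemma edge_congruent_double (L : eqType) (x : L) l i i' :
  edge_congruent l i i' ->
  cyclic_double x (word l i) -> cyclic_double x (word l i').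
Proof.
move=> [f [fp fv fl]]; rewrite !cyclic_double_word.
move=> /hasP[j ij /andP[/eqP lj /eqP lk]].
move: lk; set k := next _ j => lk.
have ik : adj i k by rewrite /adj mem_next.
have : vertex i' (f j) (f k) by rewrite fv // /vertex /k eqxx /adj mem_next ij.
(* The correspondence may reverse the cyclic order, so either image can be the successor of the
   other. *)
case/and3P=> fj fk /orP[/eqP e|/eqP e]; apply/hasP.
  by exists (f j); rewrite // e !fl // lj lk eqxx.
by exists (f k); rewrite // e !fl // lj lk eqxx.
Qed.

(** * Exhaustive search for the tilings with lengths 0, 0, 1, 1, 2 *)

Fixpoint fillings (ws : seq (seq nat)) (ts : seq tile) :
    seq (seq (tile * seq nat)) :=
  if ts is t :: ts' then
    let compatible s w := all (fun p => adj t p.1 ==>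
      (nth 0 w (index p.1 (nbr t)) == nth 0 p.2 (index t (nbr p.1)))%N) s in
    flatten [seq [seq (t, w) :: s | w <- ws & compatible s w]
            | s <- fillings ws ts']
  else [:: [::]].

Definition filling (l : tile -> tile -> nat) (ts : seq tile) :=
  [seq (t, word l t) | t <- ts].

(** Completeness of the search: the words of a length assignment agree on common edges, so its
    filling is never discarded. *)
Lemma mem_fillings ws ts l :
  length_assignment l -> (forall i, word l i \in ws) ->
  filling l ts \in fillings ws ts.
Proof.
move=> hl lw; elim: ts => [|t ts ih] //=.
apply/flatten_mapP; exists (filling l ts) => //.
apply/map_f; rewrite mem_filter lw andbT.
apply/allP => _ /mapP[j _ ->] /=; apply/implyP => tj.
by rewrite nth_word // nth_word 1?adj_sym // (hl t j).
Qed.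

Definition arrangements (p q : bool) : seq (seq nat) :=
  [seq w <- permutations [:: 0; 0; 1; 1; 2]%N
  | (cyclic_double 0%N w == p) && (cyclic_double 1%N w == q)].

Definition rotation (i : tile) : tile :=
  match i with
  | P1 => P1 | P2 => P3 | P3 => P4 | P4 => P5 | P5 => P6 | P6 => P2
  | P7 => P8 | P8 => P9 | P9 => P10 | P10 => P11 | P11 => P7 | P12 => P12
  end.

Lemma rotation_symmetry : pattern_symmetry rotation.
Proof.
split=> [|[] []|] //.
  by exists (iter 4 rotation); case.
have : all (fun i => all (fun j => all (fun k =>
    vertex (rotation i) (rotation j) (rotation k) == vertex i j k)
    tiles) tiles) tiles by vm_compute.
by move=> /all_tilesP h i j k; apply/eqP; move: k; apply/all_tilesP; move: j;
  apply/all_tilesP.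
Qed.

Definition rotated_pattern (a b n : nat) (i j : tile) : nat :=
  pattern a b 2 (iter n rotation i) (iter n rotation j).

Lemma fillings_rotated_pattern p q s :
  s \in fillings (arrangements p q) tiles ->
  exists n, [/\ (n <= 5)%N &
    s = filling (rotated_pattern 0 1 n) tiles \/
    s = filling (rotated_pattern 1 0 n) tiles].
Proof.
have : all (fun s => has (fun n =>
    (s == filling (rotated_pattern 0 1 n) tiles) ||
    (s == filling (rotated_pattern 1 0 n) tiles)) (iota 0 5))
    (fillings (arrangements p q) tiles).
  (* The check is vacuous unless [p] and [q] both hold, as the other searches find nothing. *)
  by move: p q => [] []; vm_compute.
move/allP => h /h /hasP[n]; rewrite mem_iota /= => n5 e.
by exists n; split; [exact: ltnW | case/orP: e => /eqP; auto].
Qed.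

Lemma eq_filling l l' :
  filling l tiles = filling l' tiles ->
  forall i j, adj i j -> l i j = l' i j.
Proof.
move/eq_in_map => e i j ij; have [ei] := e i (mem_tiles i).
by rewrite -(nth_word 0%N l ij) ei nth_word.
Qed.

Lemma nat_tiling_standard l :
  length_assignment l -> edge_congruent_tiling l ->
  tiles_have_lengths l [:: 0; 0; 1; 1; 2]%N ->
  exists g, pattern_symmetry g /\
    (standard_assignment 0 1 2 (fun i j => l (g i) (g j)) \/
     standard_assignment 1 0 2 (fun i j => l (g i) (g j)))%N.
Proof.
move=> hl lc lt.
have double_eq x i : cyclic_double x (word l i) = cyclic_double x (word l P1).
  by apply/idP/idP; apply: edge_congruent_double.
have lw i : word l i \in
    arrangements (cyclic_double 0%N (word l P1)) (cyclic_double 1%N (word l P1)).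
  by rewrite mem_filter !double_eq !eqxx mem_permutations; apply: lt.
have [n [n5 e]] := fillings_rotated_pattern (mem_fillings tiles hl lw).
(* The rotation has order five, so its power [5 - n] undoes the power [n] found by the search. *)
have gs := pattern_symmetry_iter (5 - n) rotation_symmetry.
exists (iter (5 - n) rotation); split=> //; case: (gs) => _ ga _.
have rK i : iter n rotation (iter (5 - n) rotation i) = i.
  by rewrite -iterD subnKC //; case: i.
have hlg : length_assignment
    (fun i j => l (iter (5 - n) rotation i) (iter (5 - n) rotation j)).
  by move=> i j ij; rewrite hl ?ga.
rewrite !standard_assignmentP //.
by case: e => /eq_filling e; [left|right] => i j ij;
  rewrite e ?ga // /rotated_pattern !rK.
Qed.

(** * From labels to arbitrary distinct lengths *)

Lemma tiling_standard (L : eqType) (a b c : L) l :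
  a <> b -> a <> c -> b <> c -> length_assignment l ->
  edge_congruent_tiling l -> tiles_have_lengths l [:: a; a; b; b; c] ->
  exists g, pattern_symmetry g /\
    (standard_assignment a b c (fun i j => l (g i) (g j)) \/
     standard_assignment b a c (fun i j => l (g i) (g j))).
Proof.
move=> /eqP ab /eqP ac /eqP bc hl lc lt.
(* Distinctness makes the labels of [a], [b], [c] equal to 0, 1, 2; every edge has one of these
   lengths, so [nth] recovers it from its label. *)
pose code x := index x [:: a; b; c].
have codeK i j : adj i j -> nth c [:: a; b; c] (code (l i j)) = l i j.
  move=> ij; apply: nth_index.
  have := map_f (l i) ij; rewrite (perm_mem (lt i)) !inE.
  by do 4?case: eqP => //=.
have [|||g [gs e]] := @nat_tiling_standard (fun i j => code (l i j)).
- by move=> i j /hl ->.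
- by move=> i i'; apply: edge_congruent_map.
- move=> i; have := perm_map code (lt i); rewrite -word_map.
  by rewrite /code /= !eqxx (negPf ab) (negPf ac) (negPf bc).
exists g; split=> //; case: (gs) => _ ga _.
have hlg : length_assignment (fun i j => l (g i) (g j)).
  by move=> i j ij; rewrite hl ?ga.
move: e; rewrite !standard_assignmentP //; last by move=> i j /hlg ->.
  by case=> e; [left|right] => i j ij;
    rewrite -codeK ?ga // e // (pattern_map (nth c [:: a; b; c])).
by move=> i j /hlg ->.
Qed.

Theorem proposition12 (R : realType) (a b c : {posnum R})
    (hab : a <> b) (hac : a <> c) (hbc : b <> c)
    (l : tile -> tile -> {posnum R}) (hl : length_assignment l) :
  (edge_congruent_tiling l /\ tiles_have_lengths l [:: a; a; b; b; c])
  <->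
  (exists g : tile -> tile,
     pattern_symmetry g /\
     (standard_assignment a b c (fun i j => l (g i) (g j)) \/
      standard_assignment b a c (fun i j => l (g i) (g j)))).
Proof.
split=> [[lc lt]|[g [gs []]]]; first exact: tiling_standard.
  exact: standard_assignment_tiling.
(* Here [a] and [b] are exchanged, which leaves the multiset of lengths unchanged. *)
move=> /(standard_assignment_tiling hl gs)[lc lt]; split=> // i.
by rewrite (perm_trans (lt i)) // (perm_catCA [:: b; b] [:: a; a] [:: c]).
Qed.
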